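(* Let $n\ge2$ and let $M=(m_{kl})\in\mathbb{R}^{n\times n}$ be a real Gram matrix satisfying $|m_{kl}|<\sqrt{m_{kk}m_{ll}}$ for all $k\neq l$. Let $\Delta=\mathrm{Diag}(M)$, and for each $\alpha$ in $$\mathcal{I}_\Delta(M)=\{\alpha\in\mathbb{C}^n:\ \alpha_k(M\alpha)_k=m_{kk}\text{ for every }k\in\{1,\dots,n\}\}$$ define $$c_\Delta(\alpha)=\frac{\det\Delta}{\det\bigl(\Delta+\mathrm{D}(\alpha)M\mathrm{D}(\alpha)\bigr)}.$$ Then $\mathcal{I}_\Delta(M)\subset\mathbb{R}^n$, $c_\Delta(\alpha)>0$ for every $\alpha\in\mathcal{I}_\Delta(M)$, $$\sum_{\alpha\in\mathcal{I}_\Delta(M)}c_\Delta(\alpha)=1,\qquad\text{and}\qquad\sum_{\alpha\in\mathcal{I}_\Delta(M)}c_\Delta(\alpha)\,\alpha\otimes\alpha=I_n.$$ Equivalently, $\mu_\Delta=\sum_{\alpha\in\mathcal{I}_\Delta(M)}c_\Delta(\alpha)\,\delta_\alpha$ is a centered discrete isotropic probability measure on $\mathbb{R}^n$.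
   Context: A real Gram matrix is a real symmetric positive semidefinite matrix. $\mathrm{D}(x)$ denotes the diagonal matrix with diagonal $x$; $\mathrm{Diag}(M)$ denotes the diagonal matrix with the same diagonal as $M$; $x\otimes y=xy^\top$; $\delta_\alpha$ is the Dirac measure at $\alpha$. A measure $\mu$ on $\mathbb{R}^n$ is centered if $\int x\,d\mu(x)=0$ and isotropic if $\int xx^\top d\mu(x)=I_n$. *)

(* Defs.v *)
From HB Require Import structures.
From mathcomp Require Import all_boot all_order all_algebra.
From mathcomp Require Import all_classical all_reals all_analysis.
From mathcomp.real_closed Require Import complex.

Set Implicit Arguments.
Unset Strict Implicit.
Unset Printing Implicit Defensive.

Import Order.TTheory GRing.Theory Num.Theory.
Import numFieldNormedType.Exports.

Local Open Scope classical_set_scope.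
Local Open Scope ring_scope.

Definition real_gram (R : realType) (n : nat) (M : 'M[R]_n) : Prop :=
  M \is symmetricmx /\ forall x : 'cV[R]_n, 0 <= (x^T *m M *m x) 0 0.

Definition toC (R : realType) (m n : nat) (A : 'M[R]_(m, n)) : 'M[R[i]]_(m, n) :=
  map_mx (real_complex R) A.

Definition reC (R : realType) (m n : nat) (A : 'M[R[i]]_(m, n)) : 'M[R]_(m, n) :=
  map_mx (@complex.Re R) A.

Definition D (K : pzRingType) (n : nat) (x : 'cV[K]_n) : 'M[K]_n := diag_mx x^T.

Definition Diag (K : pzRingType) (n : nat) (M : 'M[K]_n) : 'M[K]_n :=
  diag_mx (\row_k M k k).

Definition tens (K : pzRingType) (n : nat) (x y : 'cV[K]_n) : 'M[K]_n := x *m y^T.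

Definition IDelta (R : realType) (n : nat) (M : 'M[R]_n) : set 'cV[R[i]]_n :=
  [set a : 'cV[R[i]]_n | forall k : 'I_n, a k 0 * (toC M *m a) k 0 = toC M k k].

(* Division is total, so positivity of cDelta M a includes that the
   denominator does not vanish. *)
Definition cDelta (R : realType) (n : nat) (M : 'M[R]_n) (a : 'cV[R[i]]_n) : R[i] :=
  let Delta := toC (Diag M) in
  \det Delta / \det (Delta + D a *m toC M *m D a).

Definition borelRn (R : realType) (n : nat) :=
  g_sigma_algebraType (@open 'cV[R]_n).

(* Vector- and matrix-valued integrals are taken entrywise, and integrability
   of the entries is part of the definition since Rintegral is total. *)
Definition centered (R : realType) (n : nat)
    (mu : {measure set (borelRn R n) -> \bar R}) : Prop :=
  (forall k, mu.-integrable setT (fun x : 'cV[R]_n => (x k 0)%:E)) /\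
  \col_k (\int[mu]_x ((x : 'cV[R]_n) k 0)) = 0 :> 'cV[R]_n.

Definition isotropic (R : realType) (n : nat)
    (mu : {measure set (borelRn R n) -> \bar R}) : Prop :=
  (forall k l, mu.-integrable setT (fun x : 'cV[R]_n => (tens x x k l)%:E)) /\
  \matrix_(k, l) (\int[mu]_x (tens (x : 'cV[R]_n) x k l)) = 1%:M :> 'M[R]_n.

Definition discrete_measure (R : realType) (n : nat)
    (mu : {measure set (borelRn R n) -> \bar R}) : Prop :=
  exists2 S : set (borelRn R n), countable S & mu.-negligible (~` S).

(* Real parts are used only to land in R and R^n: on a set IDelta M of real
   points where cDelta M is real they forget nothing. *)
Definition muDelta (R : realType) (n : nat) (M : 'M[R]_n)
    (A : set (borelRn R n)) : \bar R :=
  (\sum_(a \in IDelta M)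
     (complex.Re (cDelta M a))%:E * \d_(reC a : borelRn R n) A)%E.

(* Main.v *)
Require Import Defs.
From HB Require Import structures.
From mathcomp Require Import all_boot all_order all_algebra.
From mathcomp Require Import all_classical all_reals all_analysis.
From mathcomp.real_closed Require Import complex.
From mathcomp Require Import measurable_realfun.
From mathcomp Require Import perm ring lra.

Set Implicit Arguments.
Unset Strict Implicit.
Unset Printing Implicit Defensive.

Import Order.TTheory GRing.Theory Num.Theory.
Import numFieldNormedType.Exports.

Local Open Scope classical_set_scope.
Local Open Scope ring_scope.

(** A solution of x_k (M x)_k = m_kk has no zero coordinate, so the system says
    M x = Delta x^-1, coordinatewise.  For a complex solution x + i y the
    imaginary part of this equation gives
    y^T M y = - sum_k m_kk y_k^2 / |x_k + i y_k|^2, so y = 0 because M is positive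
    semidefinite ([root_real]); by the same monotonicity there is at most one
    solution in each open orthant ([root_unique]).

    The identities come from an interpolation formula.  The polynomial
    B(x, y) = det (Delta + D(x) M D(y)) is a Bezoutian of the system: it vanishes
    at two distinct solutions ([bezout_distinct]), and det Delta / B(x, x) is the
    weight of the solution x.  It expands as the sum over the sets S of
    w_S x^S y^S, where x^S is the product of the x_k with k in S ([bezout_expand]).
    Suppose that there are 2^n solutions, as many as sets S.  With
    X the square matrix of the values a^S, W the diagonal matrix of the w_S, and
    C the diagonal matrix of the 1 / B(a, a), the vanishing property reads
    X W X^T C = 1.  The factors being square, W X^T C X = 1 as well: the
    monomials x^S are orthogonal for the weights 1 / B(a, a) ([root_duality]).
    The pairs (0, 0), (0, {k}) and (0, {k, l}) of sets give the total mass, the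
    mean and the off-diagonal covariance, and the system itself then yields the
    diagonal covariance ([second_moment]).

    There are 2^n solutions when M is positive definite: the minimiser over an
    orthant of x^T M x / 2 - sum_k m_kk ln |x_k| is one ([orthant_root_exists]).
    For a singular M some orthants contain no solution.  The matrices
    M_t = (1 - t) M + t Delta have the diagonal of M, and they are positive
    definite for 0 < t; let t tend to 0.  The solution of M_t in a given orthant
    either converges to the solution of M there or leaves every bounded set.  In
    the second case its weight c tends to 0, because c x_k^2 <= 1, and
    c x_k x_l tends to 0 for k <> l, because c (x_k x_l)^2 is bounded: the
    orthogonality relation for S = T = {k, l} bounds it by the inverse of a
    positive 2 x 2 minor, which is where |m_kl| < sqrt (m_kk m_ll) is used.
    Hence mass, mean and off-diagonal covariance survive in the limit
    ([gram_quadrature]). *)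

(** * The Bezoutian of the system and the orthogonality of monomials *)

Definition is_root (K : pzRingType) (n : nat) (M : 'M[K]_n) (x : 'cV[K]_n) :=
  forall k, x k 0 * (M *m x) k 0 = M k k.

(** Up to the factor prod_k y_k this is the determinant of the divided-difference
    matrix D(x) M + D(M y) of the system, when y is a solution. *)
Definition bezout (K : comPzRingType) (n : nat) (M : 'M[K]_n) (x y : 'cV[K]_n) : K :=
  \det (Diag M + D x *m M *m D y).

Definition monomial (K : comPzRingType) (n : nat) (x : 'cV[K]_n) (S : {set 'I_n}) : K :=
  \prod_(k in S) x k 0.

(** This is the principal minor of M on S, times the product of the other diagonal
    entries of M. *)
Definition mixed_minor (K : comPzRingType) (n : nat) (M : 'M[K]_n) (S : {set 'I_n}) : K :=
  \det (\matrix_(k, l) (if k \in S then M k l else Diag M k l)).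

Lemma bezout_entry (K : comPzRingType) (n : nat) (M : 'M[K]_n) (x y : 'cV[K]_n) k l :
  (Diag M + D x *m M *m D y) k l =
  x k 0 * M k l * y l 0 + Diag M k l.
Proof. by rewrite mxE mul_mx_diag mxE mul_diag_mx !mxE addrC. Qed.

(** In the Leibniz formula, a permutation contributes to the set S of rows taken
    from D(x) M D(y) only if it fixes the complement of S.  It then permutes S, so
    the column factors contribute y^S, just as the row factors contribute x^S. *)
Lemma bezout_expand (K : comPzRingType) (n : nat) (M : 'M[K]_n) (x y : 'cV[K]_n) :
  bezout M x y = \sum_(S : {set 'I_n}) mixed_minor M S * (monomial x S * monomial y S).
Proof.
rewrite /bezout /mixed_minor {1}/determinant.
under eq_bigr => s _.
  under eq_bigr => k _ do rewrite bezout_entry.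
  rewrite bigA_distr mulr_sumr.
  over.
rewrite exchange_big /=; apply: eq_bigr => S _.
rewrite mulr_suml; apply: eq_bigr => s _.
rewrite -mulrA; congr (_ * _).
under [in RHS]eq_bigr => k _ do rewrite mxE.
have [/existsP[k /andP[kS sk]]|] := boolP [exists k, (k \notin S) && (s k != k)].
  by rewrite (bigD1 k)//= [in RHS](bigD1 k)//= (negbTE kS) !mxE eq_sym (negbTE sk) mulr0n !mul0r.
rewrite negb_exists => /forallP H.
have Hs k : k \notin S -> s k = k.
  by move=> kS; have := H k; rewrite kS /= negbK => /eqP.
have HS k : (s k \in S) = (k \in S).
  have [kS|kS] := boolP (k \in S); last by rewrite Hs // (negbTE kS).
  apply: contraT => skS; have := Hs _ skS => /perm_inj E.
  by rewrite E kS in skS.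
have Ey : monomial y S = \prod_(k in S) y (s k) 0.
  rewrite /monomial (reindex_inj (@perm_inj _ s)) /=.
  by apply: eq_bigl => k; rewrite HS.
rewrite Ey /monomial (bigID (mem S)) /= [in RHS](bigID (mem S)) /=.
rewrite mulrAC -big_split -big_split /=; congr (_ * _).
  by apply: eq_bigr => k kS; rewrite kS; ring.
by apply: eq_bigr => k kS; rewrite (negbTE kS).
Qed.

Lemma mixed_minor0 (K : comPzRingType) (n : nat) (M : 'M[K]_n) :
  mixed_minor M finset.set0 = \det (Diag M).
Proof. by congr determinant; apply/matrixP => k l; rewrite !mxE finset.in_set0. Qed.

Lemma monomial0 (K : comPzRingType) (n : nat) (x : 'cV[K]_n) : monomial x finset.set0 = 1.
Proof. by rewrite /monomial big_set0. Qed.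

Lemma monomial2 (K : comPzRingType) (n : nat) (x : 'cV[K]_n) k l : k != l ->
  monomial x [set k; l]%SET = x k 0 * x l 0.
Proof. by move=> kl; rewrite /monomial big_setU1 ?inE //= big_set1. Qed.

Lemma mixed_minor2 (K : comPzRingType) (n : nat) (M : 'M[K]_n) k l : k != l ->
  mixed_minor M [set k; l]%SET = (M k k * M l l - M k l * M l k) *
    \prod_(i | (i != k) && (i != l)) M i i.
Proof.
move=> kl; rewrite /mixed_minor /determinant.
have tn1 : tperm k l != 1%g.
  by apply: contra_neq kl => E; rewrite -(tpermL k l) E perm1.
have spl F : \prod_i F i = F k * F l * \prod_(i | (i != k) && (i != l)) F i :> K.
  rewrite (bigD1 k)//= (bigD1 l) 1?eq_sym //= mulrA; congr (_ * _).
(* Outside k and l the rows are diagonal, so that only the identity and the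
   transposition of k and l survive. *)
have outer (s : 'S_n) : (forall i, i != k -> i != l -> s i = i) ->
    \prod_(i | (i != k) && (i != l))
      (\matrix_(i, j) (if i \in [set k; l]%SET then M i j else Diag M i j)) i (s i) =
    \prod_(i | (i != k) && (i != l)) M i i.
  move=> Hs; apply: eq_bigr => i /andP[ik il].
  by rewrite Hs // !mxE !inE (negbTE ik) (negbTE il) eqxx mulr1n.
rewrite (bigD1 (1%g : {perm 'I_n}))//= (bigD1 (tperm k l))//=.
rewrite [X in _ + (_ + X)]big1 ?addr0; last first.
  move=> s /andP[s1 st].
  have [/existsP[i /and3P[ik il si]]|] := boolP [exists i, [&& i != k, i != l & s i != i]].
    rewrite (bigD1 i)//= !mxE !inE (negbTE ik) (negbTE il) /= eq_sym (negbTE si).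
    by rewrite mulr0n mul0r mulr0.
  rewrite negb_exists => /forallP H; exfalso.
  have Hs i : i != k -> i != l -> s i = i.
    by move=> ik il; have := H i; rewrite ik il /= negbK => /eqP.
  have HS j : j \in [set k; l]%SET -> s j \in [set k; l]%SET.
    move=> jS; apply: contraT; rewrite !inE negb_or => /andP[jk jl].
    have /perm_inj E := Hs _ jk jl.
    by move: jS; rewrite !inE -E (negbTE jk) (negbTE jl).
  have sk := HS k; have sl := HS l; rewrite !inE !eqxx orbT /= in sk sl.
  have {sk} sk := sk isT; have {sl} sl := sl isT.
  have snkl : s k != s l by rewrite (inj_eq perm_inj).
  move/orP: sk => [/eqP sk|/eqP sk].
    move/negP: s1; apply; apply/eqP/permP => i; rewrite perm1.
    have [->//|ik] := eqVneq i k; have [->|il] := eqVneq i l; last exact: Hs.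
    by move: sl; rewrite sk in snkl; rewrite eq_sym (negbTE snkl) => /eqP.
  move/negP: st; apply; apply/eqP/permP => i.
  have [->|ik] := eqVneq i k; first by rewrite tpermL.
  have [->|il] := eqVneq i l; last by rewrite tpermD 1?eq_sym // Hs.
  rewrite tpermR; rewrite sk in snkl; move: sl; by rewrite orbC eq_sym (negbTE snkl) => /eqP.
rewrite odd_perm1 odd_tperm kl expr0 expr1 !spl outer; last by move=> *; rewrite perm1.
rewrite outer; last by move=> *; rewrite tpermD 1?eq_sym.
by rewrite !perm1 tpermL tpermR !mxE !inE !eqxx orbT /=; ring.
Qed.

Lemma root_neq0 (K : fieldType) (n : nat) (M : 'M[K]_n) (x : 'cV[K]_n) k :
  M k k != 0 -> is_root M x -> x k 0 != 0.
Proof. by move=> Mk /(_ k); apply: contra_eq_neq => ->; rewrite mul0r eq_sym. Qed.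

Lemma root_mul (K : fieldType) (n : nat) (M : 'M[K]_n) (x : 'cV[K]_n) k :
  M k k != 0 -> is_root M x -> (M *m x) k 0 = M k k / x k 0.
Proof.
move=> Mk xr; rewrite -(xr k) mulrAC divff ?mul1r//.
exact: root_neq0 Mk xr.
Qed.

(** The matrix Delta + D(x) M D(y) annihilates the vector with entries
    (x_k - y_k) / y_k. *)
Lemma bezout_distinct (K : fieldType) (n : nat) (M : 'M[K]_n) (x y : 'cV[K]_n) :
  (forall k, M k k != 0) -> is_root M x -> is_root M y -> x != y -> bezout M x y = 0.
Proof.
move=> M0 xr yr xy; apply/eqP; rewrite /bezout -det_tr; apply/det0P.
exists (\row_k ((x k 0 - y k 0) / y k 0)).
  apply: contra xy => /eqP /rowP E; apply/eqP/colP => k.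
  have /eqP := E k; rewrite !mxE mulf_eq0 invr_eq0 (negbTE (root_neq0 (M0 k) yr)) orbF.
  by rewrite subr_eq0 => /eqP.
apply/rowP => k; rewrite !mxE.
under eq_bigr => l _ do rewrite [X in _ * X]mxE bezout_entry mulrDr.
rewrite big_split /= [X in _ + X](bigD1 k)//= [X in _ + (_ + X)]big1 ?addr0; last first.
  by move=> l lk; rewrite !mxE eq_sym (negbTE lk) mulr0n mulr0.
have yk := root_neq0 (M0 k) yr; have xk := root_neq0 (M0 k) xr.
have -> : \sum_i (\row_k0 ((x k0 0 - y k0 0) / y k0 0)) 0 i * (x k 0 * M k i * y i 0) =
   x k 0 * ((M *m x) k 0 - (M *m y) k 0).
  rewrite !mxE -sumrB mulr_sumr; apply: eq_bigr => l _.
  by rewrite !mxE; have yl := root_neq0 (M0 l) yr; field.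
by rewrite !root_mul// !mxE eqxx mulr1n; field; rewrite xk yk.
Qed.

(** The monomials are orthogonal for the weights 1 / B(a, a): a one-sided inverse
    of a square matrix is two-sided, which is why the solutions are indexed by the
    subsets of the indices. *)
Lemma root_duality (K : fieldType) (n : nat) (M : 'M[K]_n)
    (a : {set 'I_n} -> 'cV[K]_n) :
  (forall k, M k k != 0) -> (forall E, is_root M (a E)) -> injective a ->
  (forall E, bezout M (a E) (a E) != 0) ->
  forall S T, mixed_minor M S * \sum_E (monomial (a E) S * monomial (a E) T / bezout M (a E) (a E)) = (S == T)%:R.
Proof.
move=> M0 ar ai aJ S T.
pose N := #|{: {set 'I_n}}|.
pose e (i : 'I_N) : {set 'I_n} := enum_val i.
pose A : 'M[K]_N := \matrix_(i, j) monomial (a (e i)) (e j).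
pose B : 'M[K]_N := \matrix_(i, j) (mixed_minor M (e i) * (monomial (a (e j)) (e i) / bezout M (a (e j)) (a (e j)))).
have reN F : \sum_(E : {set 'I_n}) F E = \sum_(i < N) F (e i) :> K.
  by rewrite (reindex e) //=; apply: onW_bij; exact: enum_val_bij.
have AB : A *m B = 1%:M.
  apply/matrixP => i j; rewrite !mxE.
  have -> : \sum_k A i k * B k j = bezout M (a (e i)) (a (e j)) / bezout M (a (e j)) (a (e j)).
    rewrite bezout_expand reN mulr_suml; apply: eq_bigr => k _; rewrite !mxE; ring.
  have [->|ij] := eqVneq i j; first by rewrite divff.
  rewrite bezout_distinct ?mul0r//.
  by rewrite (inj_eq ai) /e (inj_eq enum_val_inj).
have /matrixP/(_ (enum_rank S) (enum_rank T)) := mulmx1C AB.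
rewrite !mxE (inj_eq enum_rank_inj) => <-.
rewrite reN mulr_sumr; apply: eq_bigr => i _; rewrite !mxE /e !enum_rankK; ring.
Qed.

(** * Gram matrices: positivity, uniqueness and a priori bounds *)

(** On the segment from the identity matrix to A the form stays positive definite,
    so the determinant, a polynomial in the parameter, keeps the sign of det 1. *)
Lemma det_gt0 (R : rcfType) (n : nat) (A : 'M[R]_n) :
  (forall x : 'cV[R]_n, x != 0 -> 0 < (x^T *m A *m x) 0 0) -> 0 < \det A.
Proof.
move=> Apos.
pose p : {poly R} := \det ((1 - 'X) *: 1%:M + 'X *: map_mx polyC A).
have pE s : p.[s] = \det ((1 - s) *: 1%:M + s *: A).
  rewrite -horner_evalE -det_map_mx; congr determinant; apply/matrixP => i j.
  rewrite !mxE /= /horner_eval; case: (i == j); rewrite !hornerE ?mulr0 ?mulr1 ?add0r //.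
have p0 : p.[0] = 1 by rewrite pE subr0 scale1r scale0r addr0 det1.
have p1 : p.[1] = \det A by rewrite pE subrr scale0r scale1r add0r.
rewrite -p1 ltNge; apply/negP => p1le.
have [|s] := @poly_ivt R (- p) 0 1 ler01.
  by rewrite !hornerN p0 lerN10 oppr_ge0.
move=> /andP[s0 s1]; rewrite rootN => /rootP; rewrite pE => /eqP.
rewrite -det_tr => /det0P[v v0 vA].
have w0 : v^T != 0 by rewrite -(inj_eq trmx_inj) trmxK trmx0.
have := Apos _ w0; rewrite trmxK => vpos.
have vv : 0 < (v *m v^T) 0 0.
  rewrite lt_neqAle; apply/andP; split; last first.
    by rewrite mxE sumr_ge0// => i _; rewrite mxE -expr2 sqr_ge0.
  apply: contra v0; rewrite eq_sym mxE psumr_eq0; last first.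
    by move=> i _; rewrite mxE -expr2 sqr_ge0.
  move/allP => H; apply/eqP/rowP => i; rewrite mxE.
  have := H i (mem_index_enum _); rewrite mxE -expr2 sqrf_eq0; exact/eqP.
have : ((1 - s) *: (v *m v^T) + s *: (v *m A *m v^T)) 0 0 = 0.
  have -> : (1 - s) *: (v *m v^T) + s *: (v *m A *m v^T) =
     (v *m ((1 - s) *: 1%:M + s *: A)^T *m v^T)^T.
    rewrite !trmx_mul !trmxK mulmxDl mulmxDr -!scalemxAl -!scalemxAr mul1mx.
    by rewrite mulmxA.
  by rewrite vA mul0mx trmx0 mxE.
have E : forall (u w : R), 0 < u -> 0 < w -> (1 - s) * u + s * w = 0 -> False.
  move=> u w u_gt0 w_gt0; have [->|sn] := eqVneq s 0; first by nra.
  have : 0 < s by rewrite lt_neqAle eq_sym sn.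
  by nra.
by rewrite [LHS]mxE [X in X + _]mxE [X in _ + X]mxE; exact: E vv vpos.
Qed.

Lemma gram_sym (R : realType) (n : nat) (M : 'M[R]_n) : real_gram M -> M^T = M.
Proof.
by case; rewrite qualifE => /eqP; rewrite expr0 scale1r map_mx_id // => <-.
Qed.

Lemma quadE (K : pzRingType) (n : nat) (M : 'M[K]_n) (x y : 'cV[K]_n) :
  (x^T *m M *m y) 0 0 = \sum_k x k 0 * (M *m y) k 0.
Proof. by rewrite -mulmxA mxE; apply: eq_bigr => k _; rewrite mxE. Qed.

Lemma bezout_gt0 (R : realType) (n : nat) (M : 'M[R]_n) (x : 'cV[R]_n) :
  real_gram M -> (forall k, 0 < M k k) -> 0 < bezout M x x.
Proof.
move=> [_ Mpos] M0; apply: det_gt0 => v v0.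
rewrite mulmxDr mulmxDl mxE; apply: ltr_wpDr.
  have -> : v^T *m (D x *m M *m D x) *m v = (D x *m v)^T *m M *m (D x *m v).
    by rewrite trmx_mul /D tr_diag_mx !mulmxA.
  exact: Mpos.
rewrite quadE; under eq_bigr do rewrite mul_diag_mx !mxE mulrCA -expr2.
rewrite lt_neqAle sumr_ge0 ?andbT; last by move=> k _; rewrite mulr_ge0 ?sqr_ge0// ltW.
apply: contra v0; rewrite eq_sym psumr_eq0; last first.
  by move=> k _; rewrite mulr_ge0 ?sqr_ge0// ltW.
move/allP => H; apply/eqP/colP => k; rewrite mxE.
have := H k (mem_index_enum _); rewrite mulf_eq0 (gt_eqF (M0 k)) sqrf_eq0; exact/eqP.
Qed.

(** The map x |-> M x is monotone, whereas x |-> x^-1 is strictly decreasing on an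
    orthant. *)
Lemma root_unique (R : realType) (n : nat) (M : 'M[R]_n) (x y : 'cV[R]_n) :
  real_gram M -> (forall k, 0 < M k k) -> is_root M x -> is_root M y ->
  (forall k, 0 < x k 0 * y k 0) -> x = y.
Proof.
move=> [_ Mpos] M0 xr yr xy.
have M0' k : M k k != 0 by rewrite gt_eqF.
have := Mpos (x - y); rewrite quadE.
have -> : \sum_k (x - y) k 0 * (M *m (x - y)) k 0 =
   - \sum_k M k k * (x k 0 - y k 0) ^+ 2 / (x k 0 * y k 0).
  rewrite -sumrN; apply: eq_bigr => k _; rewrite mulmxBr [(x - y) k 0]mxE.
  rewrite [(M *m x - M *m y) k 0]mxE [(- y) k 0]mxE [(- (M *m y)) k 0]mxE.
  rewrite !root_mul//; field.
  by rewrite (root_neq0 (M0' k) xr) (root_neq0 (M0' k) yr).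
have T k : 0 <= M k k * (x k 0 - y k 0) ^+ 2 / (x k 0 * y k 0).
  by rewrite divr_ge0 ?(ltW (xy k))// mulr_ge0 ?sqr_ge0// ltW.
rewrite oppr_ge0 => s0.
have : \sum_k M k k * (x k 0 - y k 0) ^+ 2 / (x k 0 * y k 0) == 0.
  by rewrite eq_le s0 sumr_ge0.
rewrite psumr_eq0// => /allP H; apply/colP => k.
have := H k (mem_index_enum _).
rewrite mulf_eq0 invr_eq0 (gt_eqF (xy k)) orbF mulf_eq0 (negbTE (M0' k)) sqrf_eq0 subr_eq0.
exact/eqP.
Qed.

(** A regularisation of a Gram matrix that keeps its diagonal and dominates
    t Diag M. *)
Definition damp (K : pzRingType) (n : nat) (M : 'M[K]_n) (t : K) : 'M[K]_n :=
  (1 - t) *: M + t *: Diag M.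

Lemma dampE (K : pzRingType) (n : nat) (M : 'M[K]_n) (t : K) k l :
  damp M t k l = if k == l then M k k else (1 - t) * M k l.
Proof.
rewrite !mxE; case: eqVneq => [->|_]; rewrite ?mulr0 ?addr0//.
by rewrite mulr1n -mulrDl subrK mul1r.
Qed.

(** This keeps the solutions of the regularised systems bounded in an orthant
    where the limit system has a solution y: since x^T M y is the sum of the
    m_ll x_l / y_l, it suffices to expand 0 <= (x - y)^T M (x - y). *)
Lemma root_bound (R : realType) (n : nat) (M : 'M[R]_n) (x y : 'cV[R]_n) (t : R) :
  real_gram M -> (forall k, 0 < M k k) -> 0 <= t <= 2^-1 ->
  is_root (damp M t) x -> is_root M y -> (forall k, 0 < x k 0 * y k 0) ->
  forall k, x k 0 / y k 0 <= 2 * (\sum_l M l l) / M k k.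
Proof.
move=> hM M0 t01 xr yr xy k.
have [_ Mpos] := hM; set s := \sum_l M l l.
have M0' i : M i i != 0 by rewrite gt_eqF.
have s0 : 0 <= s by apply: sumr_ge0 => i _; exact: ltW.
have xMy : (x^T *m M *m y) 0 0 = \sum_l M l l * (x l 0 / y l 0).
  by rewrite quadE; apply: eq_bigr => l _; rewrite root_mul//; ring.
have yMx : (y^T *m M *m x) 0 0 = (x^T *m M *m y) 0 0.
  by rewrite -{1}(gram_sym hM) -[x in LHS]trmxK -!trmx_mul mxE !mulmxA.
have yMy : (y^T *m M *m y) 0 0 = s by rewrite quadE; apply: eq_bigr.
have xMtx : (1 - t) * (x^T *m M *m x) 0 0 <= s.
  have : (x^T *m damp M t *m x) 0 0 = s.
    by rewrite quadE; apply: eq_bigr => i _; rewrite xr dampE eqxx.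
  rewrite /damp mulmxDr mulmxDl -!scalemxAr -!scalemxAl mxE [X in X + _]mxE [X in _ + X]mxE => <-.
  rewrite lerDl mulr_ge0//; first by case/andP: t01.
  rewrite quadE sumr_ge0// => i _; rewrite mul_diag_mx !mxE mulrCA -expr2.
  by rewrite mulr_ge0 ?sqr_ge0// ltW.
have xMx0 := Mpos x.
have : 0 <= (x^T *m M *m x) 0 0 - 2 * (x^T *m M *m y) 0 0 + s.
  have := Mpos (x - y); rewrite [(x - y)^T]linearB /= mulmxBl mulmxBl !mulmxBr.
  have sub4 (a b c d : 'M[R]_1) :
    (a - b - (c - d)) 0 0 = a 0 0 - b 0 0 - (c 0 0 - d 0 0) by rewrite !mxE.
  by rewrite sub4 yMx yMy; lra.
rewrite ler_pdivlMr// [_ * M k k]mulrC => H.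
have T i : 0 <= M i i * (x i 0 / y i 0).
  have -> : x i 0 / y i 0 = x i 0 * y i 0 / y i 0 ^+ 2.
    by have yi := root_neq0 (M0' i) yr; field.
  by rewrite mulr_ge0 ?(ltW (M0 i))// divr_ge0 ?sqr_ge0// ltW.
have : M k k * (x k 0 / y k 0) <= (x^T *m M *m y) 0 0.
  by rewrite xMy (bigD1 k)//= lerDl sumr_ge0.
case/andP: t01 => t0 t1; nra.
Qed.

(** * Existence of a solution in every orthant, in the definite case *)

Lemma cvg_sumr (R : realType) (T : Type) (F : set_system T) (I : Type) (r : seq I)
    (P : pred I) (f : I -> T -> R) (l : I -> R) : Filter F ->
  (forall i, P i -> f i x @[x --> F] --> l i) ->
  \sum_(i <- r | P i) f i x @[x --> F] --> \sum_(i <- r | P i) l i.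
Proof. by move=> FF H; apply: cvg_big => //; exact: add_continuous. Qed.

Lemma cvg_prodr (R : realType) (T : Type) (F : set_system T) (I : Type) (r : seq I)
    (P : pred I) (f : I -> T -> R) (l : I -> R) : Filter F ->
  (forall i, P i -> f i x @[x --> F] --> l i) ->
  \prod_(i <- r | P i) f i x @[x --> F] --> \prod_(i <- r | P i) l i.
Proof. by move=> FF H; apply: cvg_big => //; exact: mul_continuous. Qed.

Section Energy.
Variables (R : realType) (n : nat) (N : 'M[R]_n).

(** On the positive orthant its critical points are the solutions of the system
    for N. *)
Definition energy (v : 'rV[R]_n) : R :=
  2^-1 * (v *m N *m v^T) 0 0 - \sum_k N k k * ln (v 0 k).

Lemma energy_continuous (v : 'rV[R]_n) : (forall k, 0 < v 0 k) ->
  {for v, continuous energy}.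
Proof.
move=> v0; have cc k : (w : 'rV[R]_n) 0 k @[w --> v] --> v 0 k.
  exact: (@coord_continuous R 1 n 0 k v).
have FF := nbhs_filter v.
have E (w : 'rV[R]_n) : (w *m N *m w^T) 0 0 = \sum_k (\sum_l w 0 l * N l k) * w 0 k.
  by rewrite mxE; apply: eq_bigr => k _; rewrite !mxE.
suff : 2^-1 * (\sum_k (\sum_l w 0 l * N l k) * w 0 k) - \sum_k N k k * ln (w 0 k) @[w --> nbhs v] -->
    2^-1 * (\sum_k (\sum_l v 0 l * N l k) * v 0 k) - \sum_k N k k * ln (v 0 k).
  rewrite /prop_for /continuous_at /energy E => H.
  by under eq_cvg do rewrite E.
apply: (@cvgB R R^o _ (nbhs v) FF); last first.
  apply: cvg_sumr => k _; apply: cvgM; first exact: cvg_cst.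
  by apply: (cvg_comp (fun w : 'rV[R]_n => w 0 k) (@ln R) (cc k)); exact: continuous_ln.
apply: (@cvgM R _ (nbhs v) FF); first exact: cvg_cst.
apply: cvg_sumr => k _; apply: (@cvgM R _ (nbhs v) FF); last exact: cc.
by apply: cvg_sumr => l _; apply: (@cvgM R _ (nbhs v) FF); [exact: cc | exact: cvg_cst].
Qed.

Lemma energy_perturb (v : 'rV[R]_n) k s : N^T = N ->
  energy (v + s *: delta_mx 0 k) - energy v =
  s * (N *m v^T) k 0 + 2^-1 * N k k * s ^+ 2 - N k k * (ln (v 0 k + s) - ln (v 0 k)).
Proof.
move=> Nsym; pose e : 'rV[R]_n := delta_mx 0 k.
have eN (w : 'cV[R]_n) : (e *m w) 0 0 = w k 0.
  by rewrite /e -rowE mxE.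
have Q : ((v + s *: e) *m N *m (v + s *: e)^T) 0 0 =
    (v *m N *m v^T) 0 0 + 2 * (s * (N *m v^T) k 0) + N k k * s ^+ 2.
  rewrite linearD linearZ /= mulmxDl mulmxDl !mulmxDr -!scalemxAl -!scalemxAr.
  have -> : v *m N *m e^T = (e *m (N *m v^T))^T.
    by rewrite !trmx_mul trmxK Nsym.
  have -> : e *m N *m e^T = (N k k)%:M.
    apply/matrixP => i j; rewrite !ord1 -mulmxA eN -[e^T]trmxK trmxK.
    by rewrite /e trmx_delta -colE !mxE eqxx mulr1n.
  rewrite -[e *m N *m v^T]mulmxA.
  have add4 (a b c d : 'M[R]_1) : (a + s *: b^T + s *: (c + s *: d)) 0 0 =
     a 0 0 + s * b 0 0 + s * (c 0 0 + s * d 0 0) by rewrite !mxE.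
  have add4' (a b c d : 'M[R]_1) : (a + s *: b^T + (s *: c + s *: (s *: d))) 0 0 =
     a 0 0 + s * b 0 0 + s * (c 0 0 + s * d 0 0) by rewrite !mxE; ring.
  rewrite ?add4 ?add4' eN [(_%:M) 0 0]mxE eqxx mulr1n; ring.
rewrite /energy -/e Q (bigD1 k)//= [in X in _ - X](bigD1 k)//=.
have -> : \sum_(i < n | i != k) N i i * ln ((v + s *: e) 0 i) =
          \sum_(i < n | i != k) N i i * ln (v 0 i).
  apply: eq_bigr => i ik; congr (_ * ln _).
  by rewrite !mxE eqxx (negbTE ik) /= mulr0 addr0.
have -> : (v + s *: e) 0 k = v 0 k + s by rewrite !mxE !eqxx /= mulr1.
by field.
Qed.

End Energy.

(** Coercivity in one variable: a sublevel set is contained in a compact interval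
    of positive numbers. *)
Lemma quad_sub_ln_bound (R : realType) (t C u : R) : 0 < t -> 0 <= C -> 0 < u ->
  2^-1 * t * u ^+ 2 - ln u <= C ->
  expR (- C) <= u /\ u <= 1 + 2 * (C + 1) / t.
Proof.
move=> t0 C0 u0 H; split.
  rewrite -[u]lnK ?posrE// ler_expR.
  have : 0 <= 2^-1 * t * u ^+ 2 by rewrite mulr_ge0 ?sqr_ge0// mulr_ge0 ?invr_ge0// ltW.
  by move=> ?; lra.
rewrite -lerBlDl ler_pdivlMr//.
have := ln_sublinear u0; case: (leP u 1) => u1 lu; first by nra.
by nra.
Qed.

(** The hypothesis N >= t Diag N makes the energy coercive on the positive orthant,
    so it has a minimiser there; in each coordinate this is an interior minimum,
    and the vanishing of the derivative is the equation of the system. *)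
Lemma positive_root_exists (R : realType) (n : nat) (N : 'M[R]_n) (t : R) :
  0 < t -> N^T = N -> (forall k, 0 < N k k) ->
  (forall x : 'cV[R]_n, t * (\sum_k N k k * x k 0 ^+ 2) <= (x^T *m N *m x) 0 0) ->
  exists x : 'cV[R]_n, (forall k, 0 < x k 0) /\ is_root N x.
Proof.
move=> t0 Nsym N0 Nt.
pose one : 'rV[R]_n := const_mx 1.
pose s := \sum_k N k k.
have s0 : 0 <= s by apply: sumr_ge0 => k _; exact: ltW.
pose C0 := `|energy N one| + t^-1 * s.
have C00 : 0 <= C0 by rewrite addr_ge0// mulr_ge0// invr_ge0 ltW.
pose C := C0 * \sum_k (N k k)^-1.
have V0 k : 0 <= (N k k)^-1 by rewrite invr_ge0 ltW.
have C1 : 0 <= C by rewrite mulr_ge0// sumr_ge0.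
have sublevel (v : 'rV[R]_n) k : (forall i, 0 < v 0 i) -> energy N v <= energy N one ->
    expR (- C) <= v 0 k /\ v 0 k <= 1 + 2 * (C + 1) / t.
  move=> v0 vle; apply: quad_sub_ln_bound => //.
  (* The energy is at least the sum of the N k k * g (v 0 k), and g is bounded
     below by - 1 / t, by completing the square after ln u < u. *)
  pose g (u : R) := 2^-1 * t * u ^+ 2 - ln u.
  have gge i : - t^-1 <= g (v 0 i).
    have tV : t * t^-1 = 1 by rewrite divff// gt_eqF.
    have tp : 0 < t^-1 by rewrite invr_gt0.
    have := ln_sublinear (v0 i); set u := v 0 i => lu.
    have : 0 <= t^-1 * (t * u - 1) ^+ 2 by rewrite mulr_ge0 ?sqr_ge0// ltW.
    have -> : t^-1 * (t * u - 1) ^+ 2 = t * u ^+ 2 - 2 * u + t^-1 by field; rewrite gt_eqF.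
    by rewrite /g => ?; lra.
  have : \sum_i N i i * g (v 0 i) <= energy N v.
    rewrite /energy.
    have := Nt v^T; rewrite (eq_bigr (fun i => N i i * v 0 i ^+ 2)); last by move=> i _; rewrite mxE.
    rewrite trmxK => Hq; rewrite (eq_bigr (fun i => 2^-1 * (t * (N i i * v 0 i ^+ 2)) - N i i * ln (v 0 i))); last first.
      by move=> i _; rewrite /g; ring.
    by rewrite sumrB -!mulr_sumr lerB// ler_pM2l ?invr_gt0//.
  rewrite (bigD1 k)//= => Hk.
  have Ho : - (t^-1 * s) <= \sum_(i | i != k) N i i * g (v 0 i).
    apply: (@le_trans _ _ (\sum_(i | i != k) - (t^-1 * N i i))).
      rewrite sumrN lerN2 /s mulr_sumr [leRHS](bigD1 k)//= lerDr mulr_ge0//; last exact: ltW.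
      by rewrite invr_ge0 ltW.
    by apply: ler_sum => i _; rewrite mulrC -mulrN ler_pM2l.
  have : N k k * g (v 0 k) <= C0.
    by rewrite /C0; have := ler_norm (energy N one); lra.
  rewrite mulrC -ler_pdivlMr// => /le_trans; apply.
  by rewrite /C ler_wpM2l// (bigD1 k)//= lerDl sumr_ge0.
(* Halving the lower bound and adding 1 to the upper one puts the sublevel set of
   the constant vector 1 in the interior of the box. *)
pose a := expR (- C) / 2; pose b := 2 + 2 * (C + 1) / t.
have a0 : 0 < a by rewrite divr_gt0// expR_gt0.
pose A := [set v : 'rV[R]_n | forall i, `[a, b]%classic (v ord0 i)].
have Apos v : A v -> forall i, 0 < v 0 i.
  by move=> Av i; have := Av i; rewrite /= in_itv/= => /andP[/(lt_le_trans a0)].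
have inBox (v : 'rV[R]_n) : (forall i, 0 < v 0 i) -> energy N v <= energy N one ->
    forall i, a < v 0 i < b.
  move=> v0 vle i; have [h1 h2] := sublevel v i v0 vle.
  have := expR_gt0 (- C) => e0; rewrite /a /b; apply/andP; split; last by lra.
  by apply: lt_le_trans h1; lra.
have A1 : A one.
  move=> i; rewrite /= in_itv/=.
  have /inBox/(_ (lexx _))/(_ i)/andP[h1 h2] : forall i, 0 < one 0 i by move=> j; rewrite mxE.
  by rewrite !ltW.
have [|||v vA vmin] := @EVT_min_rV R n (energy N) A.
- by exists one.
- by apply: (@rV_compact R n (fun=> `[a, b]%classic)) => i; exact: segment_compact.
- apply: continuous_in_subspaceT => v; rewrite inE => Av.
  by apply: energy_continuous; exact: Apos.
rewrite inE in vA; have v0 := Apos _ vA.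
have vin : forall i, a < v 0 i < b.
  by apply: inBox => //; apply: vmin; rewrite inE.
exists v^T; split=> [k|k]; first by rewrite mxE.
pose f (u : R) := (u - v 0 k) * (N *m v^T) k 0 + 2^-1 * N k k * (u - v 0 k) ^+ 2 -
   N k k * (ln u - ln (v 0 k)).
have fmin u : u \in `]a, b[%R -> f (v 0 k) <= f u.
  rewrite in_itv/= => /andP[au ub].
  have -> : f (v 0 k) = 0 by rewrite /f !subrr expr0n /= !mulr0 mul0r addr0 subr0.
  have -> : f u = energy N (v + (u - v 0 k) *: delta_mx 0 k) - energy N v.
    by rewrite energy_perturb// [v 0 k + _]addrC subrK.
  rewrite subr_ge0; apply: vmin; rewrite inE => i /=; rewrite in_itv/= !mxE eqxx /=.
  have [->|ik] := eqVneq i k; first by rewrite mulr1 addrC subrK !ltW.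
  by rewrite mulr0 addr0; have /andP[? ?] := vin i; rewrite !ltW.
have fd u : u \in `]a, b[%R -> is_derive u 1 f ((N *m v^T) k 0 + N k k * (u - v 0 k) - N k k / u).
  rewrite in_itv/= => /andP[au ub]; have u0 : 0 < u := lt_trans a0 au.
  have dl := is_derive1_ln u0.
  rewrite /f; apply: is_derive_eq; rewrite /GRing.scale /= ; field.
  by rewrite gt_eqF.
have ab : a <= b by have /andP[h1 h2] := vin k; exact: ltW (lt_trans h1 h2).
have vk : v 0 k \in `]a, b[%R by rewrite in_itv/=; exact: vin.
have := @derive1_at_min R f a b (v 0 k) ab (fun u hu => @ex_derive _ _ _ _ _ _ _ (fd u hu)) vk fmin.
move=> D0; have := @derive_val _ _ _ _ _ _ _ D0; rewrite (@derive_val _ _ _ _ _ _ _ (fd _ vk)).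
rewrite subrr mulr0 addr0 => /eqP; rewrite subr_eq0 => /eqP ->.
by rewrite mxE mulrC divfK// gt_eqF.
Qed.

(** Orthants are encoded by their sets of negative coordinates: the type that
    indexes the monomials then indexes the solutions too. *)
Definition in_orthant (R : realType) (n : nat) (E : {set 'I_n}) (x : 'cV[R]_n) :=
  forall k, 0 < (-1) ^+ (k \in E) * x k 0.

(** Conjugation by a diagonal matrix of signs brings any orthant to the positive
    one. *)
Lemma orthant_root_exists (R : realType) (n : nat) (M : 'M[R]_n) (t : R) (E : {set 'I_n}) :
  real_gram M -> (forall k, 0 < M k k) -> 0 < t <= 1 ->
  exists x : 'cV[R]_n, in_orthant E x /\ is_root (damp M t) x.
Proof.
move=> hM M0 /andP[t0 t1].
pose e k : R := (-1) ^+ (k \in E).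
have ee k : e k * e k = 1 by rewrite -expr2 sqrr_sign.
pose N : 'M[R]_n := \matrix_(k, l) (e k * damp M t k l * e l).
have Nkk k : N k k = M k k by rewrite mxE dampE eqxx mulrAC ee mul1r.
pose X (x : 'cV[R]_n) : 'cV[R]_n := \col_k (e k * x k 0).
have NX x k : (N *m x) k 0 = e k * (damp M t *m X x) k 0.
  by rewrite !mxE mulr_sumr; apply: eq_bigr => l _; rewrite !mxE; ring.
have [|||x [x0 xr]] := @positive_root_exists R n N t t0.
- apply/matrixP => k l; rewrite [LHS]mxE [LHS]mxE [RHS]mxE !dampE.
  have -> : M l k = M k l by rewrite -{1}(gram_sym hM) mxE.
  by rewrite (eq_sym l k); case: (eqVneq k l) => [->|kl]; ring.
- by move=> k; rewrite Nkk.
- move=> x; rewrite quadE.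
  have -> : \sum_k x k 0 * (N *m x) k 0 = ((X x)^T *m damp M t *m X x) 0 0.
    by rewrite quadE; apply: eq_bigr => k _; rewrite NX [X x k 0]mxE; ring.
  rewrite /damp mulmxDr mulmxDl -!scalemxAr -!scalemxAl mxE [X in _ <= X + _]mxE [X in _ <= _ + X]mxE.
  have -> : \sum_k N k k * x k 0 ^+ 2 = ((X x)^T *m Diag M *m X x) 0 0.
    rewrite quadE; apply: eq_bigr => k _.
    by rewrite Nkk mul_diag_mx !mxE -[LHS]mul1r -(ee k); ring.
  by rewrite lerDr mulr_ge0 ?subr_ge0//; case: hM.
exists (X x); split=> k; first by rewrite mxE mulrA ee mul1r.
by have := xr k; rewrite Nkk NX dampE eqxx => <-; rewrite [X x k 0]mxE; ring.
Qed.

(** * Moments of the solutions of the regularised system *)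

Lemma damp_gram (R : realType) (n : nat) (M : 'M[R]_n) (t : R) :
  real_gram M -> (forall k, 0 < M k k) -> 0 <= t <= 1 -> real_gram (damp M t).
Proof.
move=> hM M0 /andP[t0 t1]; split.
  rewrite is_hermitianmxE expr0 scale1r map_mx_id //; apply/eqP.
  by rewrite /damp linearD !linearZ /= gram_sym// tr_diag_mx.
move=> x; rewrite /damp mulmxDr mulmxDl -!scalemxAr -!scalemxAl mxE.
rewrite addr_ge0// mxE mulr_ge0 ?subr_ge0//; first by case: hM.
rewrite quadE sumr_ge0// => k _; rewrite mul_diag_mx !mxE mulrCA -expr2.
by rewrite mulr_ge0 ?sqr_ge0// ltW.
Qed.

Lemma Diag_damp (K : pzRingType) (n : nat) (M : 'M[K]_n) (t : K) :
  Diag (damp M t) = Diag M.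
Proof.
rewrite /Diag; congr diag_mx; apply/rowP => k.
by rewrite [LHS]mxE [RHS]mxE dampE eqxx.
Qed.

Definition weight (K : fieldType) (n : nat) (M : 'M[K]_n) (x : 'cV[K]_n) : K :=
  \det (Diag M) / bezout M x x.

Lemma det_Diag_gt0 (R : realType) (n : nat) (M : 'M[R]_n) :
  (forall k, 0 < M k k) -> 0 < \det (Diag M).
Proof. by move=> M0; rewrite det_diag prodr_gt0// => k _; rewrite mxE. Qed.

Lemma weight_gt0 (R : realType) (n : nat) (M : 'M[R]_n) (x : 'cV[R]_n) :
  real_gram M -> (forall k, 0 < M k k) -> 0 < weight M x.
Proof. by move=> hM M0; rewrite divr_gt0 ?det_Diag_gt0// bezout_gt0. Qed.

Lemma orthant_inj (R : realType) (n : nat) (E F : {set 'I_n}) (x : 'cV[R]_n) :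
  in_orthant E x -> in_orthant F x -> E = F.
Proof.
move=> xE xF; apply/setP => k; have := xE k; have := xF k.
by case: (k \in E); case: (k \in F) => //; rewrite ?expr0 ?expr1; lra.
Qed.

Lemma orthant_mul (R : realType) (n : nat) (E : {set 'I_n}) (x y : 'cV[R]_n) :
  in_orthant E x -> in_orthant E y -> forall k, 0 < x k 0 * y k 0.
Proof.
move=> xE yE k; have := mulr_gt0 (xE k) (yE k).
by rewrite mulrACA -expr2 sqrr_sign mul1r.
Qed.

Lemma orthant_exists (R : realType) (n : nat) (x : 'cV[R]_n) :
  (forall k, x k 0 != 0) -> exists E : {set 'I_n}, in_orthant E x.
Proof.
move=> x0; exists [set k | x k 0 < 0]%SET => k; rewrite inE.
by case: (ltrgt0P (x k 0)) (x0 k) => h // _; rewrite ?expr0 ?expr1; lra.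
Qed.

(** Averaging the k-th equation x_k (M x)_k = m_kk determines the second moment of
    x_k once the mixed moments vanish. *)
Lemma second_moment (K : fieldType) (n : nat) (M : 'M[K]_n) (I : finType) (P : pred I)
    (a : I -> 'cV[K]_n) (w : I -> K) k :
  M k k != 0 -> (forall i, P i -> is_root M (a i)) ->
  \sum_(i | P i) w i = 1 ->
  (forall l, k != l -> \sum_(i | P i) w i * (a i k 0 * a i l 0) = 0) ->
  \sum_(i | P i) w i * (a i k 0 * a i k 0) = 1.
Proof.
move=> M0 ar w1 w2; apply: (mulfI M0); rewrite mulr1.
have : \sum_(i | P i) w i * (a i k 0 * (M *m a i) k 0) = M k k.
  by rewrite (eq_bigr (fun i => w i * M k k)) -?mulr_suml ?w1 ?mul1r// => i /ar ->.
rewrite (eq_bigr (fun i => \sum_l M k l * (w i * (a i k 0 * a i l 0)))); last first.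
  by move=> i _; rewrite mxE !mulr_sumr; apply: eq_bigr => l _; ring.
rewrite exchange_big /= (bigD1 k)//= [X in _ + X]big1 ?addr0 -?mulr_sumr//.
by move=> l lk; rewrite -mulr_sumr w2 ?mulr0// eq_sym.
Qed.

Section DampMoments.
Variables (R : realType) (n : nat) (M : 'M[R]_n) (t : R) (a : {set 'I_n} -> 'cV[R]_n).
Hypotheses (hM : real_gram M) (M0 : forall k, 0 < M k k) (t01 : 0 < t <= 1).
Hypotheses (ar : forall E, is_root (damp M t) (a E)) (aE : forall E, in_orthant E (a E)).

Let N := damp M t.
Let Nkk k : N k k = M k k. Proof. by rewrite /N dampE eqxx. Qed.
Let N0 k : 0 < N k k. Proof. by rewrite Nkk. Qed.
Let hN : real_gram N.
Proof. by apply: damp_gram => //; case/andP: t01 => /ltW -> ->. Qed.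

Lemma damp_duality S T :
  mixed_minor N S * \sum_E (monomial (a E) S * monomial (a E) T / bezout N (a E) (a E)) = (S == T)%:R.
Proof.
apply: root_duality => //.
- by move=> k; rewrite gt_eqF.
- by move=> E F EF; apply: (orthant_inj (aE E)); rewrite EF.
- by move=> E; rewrite gt_eqF// bezout_gt0.
Qed.

Let damp_moment T : \sum_E weight N (a E) * monomial (a E) T = (finset.set0 == T)%:R.
Proof.
rewrite -damp_duality mixed_minor0 mulr_sumr; apply: eq_bigr => E _.
by rewrite monomial0 /weight; ring.
Qed.

Lemma damp_mass : \sum_E weight N (a E) = 1.
Proof.
have := damp_moment finset.set0; rewrite eqxx mulr1n => <-.
by apply: eq_bigr => E _; rewrite monomial0 mulr1.
Qed.

Lemma damp_offdiag k l : k != l -> \sum_E weight N (a E) * (a E k 0 * a E l 0) = 0.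
Proof.
move=> kl; have := damp_moment [set k; l]%SET.
have -> : (finset.set0 == [set k; l]%SET) = false.
  by apply/negbTE/eqP => /setP/(_ k); rewrite !inE eqxx.
by under eq_bigr => E _ do rewrite monomial2//.
Qed.

Lemma damp_mean k : \sum_E weight N (a E) * a E k 0 = 0.
Proof.
have := damp_moment [set k]%SET.
have -> : (finset.set0 == [set k]%SET) = false.
  by apply/negbTE/eqP => /setP/(_ k); rewrite !inE eqxx.
by under eq_bigr => E _ do rewrite /monomial big_set1.
Qed.

Let Wpos E : 0 < weight N (a E). Proof. exact: weight_gt0. Qed.

Lemma damp_sq_le1 E k : weight N (a E) * (a E k 0) ^+ 2 <= 1.
Proof.
have Nk : N k k != 0 by rewrite gt_eqF.
rewrite -(@second_moment R n N _ predT a (fun E => weight N (a E)) k Nk); first last.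
- by move=> l; exact: damp_offdiag.
- exact: damp_mass.
- by move=> *; exact: ar.
by rewrite (bigD1 E)//= lerDl sumr_ge0// => F _; rewrite mulr_ge0 ?sqr_ge0// ltW.
Qed.

(** Orthogonality with S = T = {k, l} bounds each term by the inverse of a minor.
    The bound does not depend on t, because the off-diagonal entries of the
    regularised matrix are at most those of M in absolute value. *)
Lemma damp_sqsq_le E k l : k != l -> M k l ^+ 2 < M k k * M l l ->
  weight N (a E) * (a E k 0 * a E l 0) ^+ 2 <= M k k * M l l / (M k k * M l l - M k l ^+ 2).
Proof.
move=> kl hkl; rewrite ler_pdivlMr ?subr_gt0//.
pose Q := \prod_(i | (i != k) && (i != l)) N i i.
have Q0 : 0 < Q by rewrite prodr_gt0.
have dD : \det (Diag N) = M k k * M l l * Q.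
  rewrite det_diag (eq_bigr (fun i => N i i)); last by move=> i _; rewrite mxE.
  by rewrite (bigD1 k)//= (bigD1 l) 1?eq_sym //= !Nkk mulrA.
have mle : (M k k * M l l - M k l ^+ 2) * Q <= mixed_minor N [set k; l]%SET.
  rewrite mixed_minor2// -/Q ler_pM2r// !Nkk lerB// /N !dampE (eq_sym l k) (negbTE kl).
  have -> : M l k = M k l by rewrite -{1}(gram_sym hM) mxE.
  rewrite mulrACA -!expr2 -[leRHS]mul1r ler_wpM2r ?sqr_ge0//.
  by case/andP: t01 => t0 t1; rewrite expr_le1// ?subr_ge0// lerBlDr lerDl ltW.
have minor_gt0 : 0 < mixed_minor N [set k; l]%SET.
  by apply: lt_le_trans mle; rewrite mulr_gt0 ?subr_gt0.
have : mixed_minor N [set k; l]%SET * ((a E k 0 * a E l 0) ^+ 2 / bezout N (a E) (a E)) <= 1.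
  have := damp_duality [set k; l]%SET [set k; l]%SET; rewrite eqxx mulr1n => <-.
  rewrite ler_pM2l// (bigD1 E)//= monomial2// -expr2 lerDl sumr_ge0// => F _.
  by rewrite -expr2 divr_ge0 ?sqr_ge0// ltW// bezout_gt0.
have Jp := bezout_gt0 (a E) hN N0; have T0 : 0 <= (a E k 0 * a E l 0) ^+ 2 / bezout N (a E) (a E).
  by rewrite divr_ge0 ?sqr_ge0// ltW.
move=> /(le_trans (ler_wpM2r T0 mle)) H.
have -> : weight N (a E) * (a E k 0 * a E l 0) ^+ 2 * (M k k * M l l - M k l ^+ 2) =
  M k k * M l l * ((M k k * M l l - M k l ^+ 2) * Q * ((a E k 0 * a E l 0) ^+ 2 / bezout N (a E) (a E))).
  by rewrite /weight dD; ring.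
by rewrite ger_pMr// mulr_gt0.
Qed.

End DampMoments.

(** * The limit of vanishing regularisation *)

Lemma ultra_fmap (T U : Type) (f : T -> U) (F : set_system T) :
  UltraFilter F -> UltraFilter (f @ F).
Proof.
move=> FU; split; first exact: fmap_proper_filter.
move=> G GP sG; rewrite eqEsubset; split=> // A GA.
have [//|FnA] := in_ultra_setVsetC (f @^-1` A) FU.
have GnA : G (~` A) by exact: sG.
by have := @filterI _ G filter_filter _ _ GA GnA; rewrite setICr => G0; case: (@filter_not_empty _ G GP (G0 _)).
Qed.

Lemma ultra_bounded_cvg (R : realType) (T : Type) (F : set_system T) (f : T -> R) (K : R) :
  UltraFilter F -> F [set x | `|f x| <= K] -> exists l : R, f x @[x --> F] --> l.
Proof.
move=> FU FK; have := @segment_compact R (- K) K.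
rewrite compact_ultra => /(_ (f @ F) (ultra_fmap f FU)) [].
  change (F (f @^-1` `[- K, K])); apply: filterS FK => x fx.
  by rewrite /= in_itv/= -ler_norml.
by move=> l [_ fl]; exists l.
Qed.

Lemma cvg_det (R : realType) (T : Type) (F : set_system T) (n : nat)
    (A : T -> 'M[R]_n) (B : 'M[R]_n) : Filter F ->
  (forall k l, A x k l @[x --> F] --> B k l) -> \det (A x) @[x --> F] --> \det B.
Proof.
move=> FF H; apply: cvg_sumr => s _; apply: cvgM; first exact: cvg_cst.
by apply: cvg_prodr => k _; exact: H.
Qed.

(** G is the set of the orthants that contain a solution.  Limits are taken along
    an ultrafilter: it decides, for each of the finitely many orthants, whether
    the solutions of the regularised systems stay bounded, and it makes them
    converge if they do. *)
Lemma gram_quadrature (R : realType) (n : nat) (M : 'M[R]_n) :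
  real_gram M -> (forall k, 0 < M k k) ->
  (forall k l, k != l -> M k l ^+ 2 < M k k * M l l) ->
  exists (G : {set {set 'I_n}}) (x : {set 'I_n} -> 'cV[R]_n),
    [/\ forall E, E \in G -> is_root M (x E) /\ in_orthant E (x E),
        forall y, is_root M y -> exists2 E, E \in G & y = x E,
        \sum_(E in G) weight M (x E) = 1,
        forall k, \sum_(E in G) weight M (x E) * x E k 0 = 0
      & forall k l, \sum_(E in G) weight M (x E) * (x E k 0 * x E l 0) = (k == l)%:R].
Proof.
move=> hM M0 hlt.
pose t (j : nat) : R := 2^-1 * harmonic j.
have t01 j : 0 < t j <= 2^-1.
  rewrite /t mulr_gt0 ?invr_gt0//= ?ltr0n// -[leRHS]mulr1 ler_pM2l ?invr_gt0//.
  by rewrite invf_le1 ?ltr0n// ler1n.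
have t01' j : 0 < t j <= 1.
  by have /andP[h1 h2] := t01 j; rewrite h1 /=; lra.
(* sol j E is the solution in the orthant E for the parameter t j. *)
have /choice[sol ha] (j : nat) : exists a : {set 'I_n} -> 'cV[R]_n, forall E,
    in_orthant E (a E) /\ is_root (damp M (t j)) (a E).
  have /choice[a aP] (E : {set 'I_n}) : exists x : 'cV[R]_n,
      in_orthant E x /\ is_root (damp M (t j)) x by exact: orthant_root_exists.
  by exists a.
have aE j E : in_orthant E (sol j E) by have [] := ha j E.
have ar j E : is_root (damp M (t j)) (sol j E) by have [] := ha j E.
have [U [UU Uoo]] := @ultraFilterLemma nat \oo _.
have tU : t j @[j --> U] --> (0 : R).
  have : t j @[j --> \oo] --> (0 : R).
    by rewrite -(mulr0 (2^-1 : R)); apply: cvgM; [exact: cvg_cst | exact: cvg_harmonic].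
  by move=> h A /h; exact: Uoo.
have dU k l : damp M (t j) k l @[j --> U] --> M k l.
  under eq_cvg do rewrite dampE.
  have [<-|kl] := eqVneq k l; first exact: cvg_cst.
  suff : (1 - t j) * M k l @[j --> U] --> (1 - 0) * M k l by rewrite subr0 mul1r.
  by apply: cvgM; [apply: cvgB => //; exact: cvg_cst | exact: cvg_cst].
pose W j E := weight (damp M (t j)) (sol j E).
have W0 j E : 0 < W j E.
  apply: weight_gt0 => [|k]; last by rewrite dampE eqxx.
  by apply: damp_gram => //; have /andP[/ltW -> ->] := t01' j.
pose bdd E := exists K : R, U [set j | forall k, `|sol j E k 0| <= K].
have bdd_lim E : bdd E -> exists x : 'cV[R]_n, forall k, sol j E k 0 @[j --> U] --> x k 0.
  move=> [K HK].
  have /choice[l hl] (k : 'I_n) : exists l : R, sol j E k 0 @[j --> U] --> l.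
    by apply: (@ultra_bounded_cvg R nat U _ K) => //; apply: filterS HK => j /(_ k).
  by exists (\col_k l k) => k; rewrite mxE.
have nbdd E : ~ bdd E -> exists k, forall K : R, U [set j | K < `|sol j E k 0|].
  move=> nb; apply: contrapT => /forallNP H; apply: nb.
  have /choice[K hK] (k : 'I_n) : exists K : R, U [set j | `|sol j E k 0| <= K].
    have /existsNP[K hK] := H k; exists K.
    have [//|h] := in_ultra_setVsetC [set j | `|sol j E k 0| <= K] UU.
    exfalso; apply: hK; apply: filterS h => j /= /negP; rewrite -ltNge.
    exact.
  exists (\sum_k `|K k|).
  apply: filterS (@filter_forall nat 'I_n _ U _ hK) => j /= h k; apply: le_trans (h k) _.
  by rewrite (bigD1 k)//= (le_trans (ler_norm _))// lerDl sumr_ge0.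
(* An unbounded coordinate forces the weight to 0, as c x_k^2 <= 1. *)
have W_small E : ~ bdd E -> W j E @[j --> U] --> (0 : R).
  move=> /nbdd[k hk]; apply/cvgr0Pnorm_lt => e e0.
  apply: filterS (hk (1 + e^-1)) => j /= hj.
  have := damp_sq_le1 hM M0 (t01' j) (ar j) (aE j) E k.
  rewrite -/(W j E) gtr0_norm// -real_normK ?num_real//.
  set u := `|sol j E k 0| in hj *; move=> hW.
  have ie : 0 < e^-1 by rewrite invr_gt0.
  have : W j E * e^-1 < 1.
    apply: lt_le_trans hW; rewrite ltr_pM2l//; nra.
  by rewrite ltr_pdivrMr// mul1r.
(* From c p^2 <= B follows (c p)^2 <= c B, so c p tends to 0 along with c. *)
have WB_small E (p : nat -> R) (B : R) : 0 <= B -> ~ bdd E ->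
    (forall j, W j E * p j ^+ 2 <= B) -> W j E * p j @[j --> U] --> (0 : R).
  move=> B0 nb hp; apply/cvgr0Pnorm_lt => e e0.
  have d0 : 0 < e ^+ 2 / (B + 1) by rewrite divr_gt0 ?exprn_gt0// ltr_wpDl.
  have /cvgr0Pnorm_lt/(_ _ d0) := W_small E nb.
  apply: filterS => j; rewrite gtr0_norm// ltr_pdivlMr ?ltr_wpDl// => h.
  have Wp := W0 j E; have := hp j.
  rewrite -(@ltr_pXn2r _ 2) ?nnegrE ?normr_ge0 ?(ltW e0)// real_normK ?num_real//.
  have -> : (W j E * p j) ^+ 2 = W j E * (W j E * p j ^+ 2) by ring.
  nra.
pose G := [set E | `[< bdd E >]]%SET.
have inG E : reflect (bdd E) (E \in G) by rewrite inE; exact: asboolP.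
have /choice[x hx] (E : {set 'I_n}) : exists x : 'cV[R]_n,
    bdd E -> forall k, sol j E k 0 @[j --> U] --> x k 0.
  have [/bdd_lim[x hx]|nb] := pselect (bdd E); first by exists x.
  by exists 0.
have xr E : bdd E -> is_root M (x E).
  move=> /hx hE k.
  have : sol j E k 0 * (damp M (t j) *m sol j E) k 0 @[j --> U] --> x E k 0 * (M *m x E) k 0.
    rewrite mxE; under eq_cvg do rewrite mxE.
    by apply: cvgM => //; apply: cvg_sumr => l _; apply: cvgM.
  under eq_cvg do rewrite ar dampE eqxx.
  move=> h; apply: (@cvg_unique _ (@Rhausdorff R) _ _ _ _ h); exact: cvg_cst.
have xE E : bdd E -> in_orthant E (x E).
  move=> bE k; rewrite lt_neqAle eq_sym mulf_neq0 ?signr_eq0//=; last first.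
    by apply: root_neq0 (xr E bE); rewrite gt_eqF.
  have h : (-1) ^+ (k \in E) * sol j E k 0 @[j --> U] --> (-1) ^+ (k \in E) * x E k 0.
    by apply: cvgM; [exact: cvg_cst | exact: hx].
  by apply: (cvgr_to_ge h); apply: nearW => j; exact/ltW/aE.
have WU E : bdd E -> W j E @[j --> U] --> weight M (x E).
  move=> bE; apply: cvgM.
    by under eq_cvg do rewrite Diag_damp; exact: cvg_cst.
  apply: cvgV; first by rewrite gt_eqF// bezout_gt0.
  apply: cvg_det => k l; rewrite bezout_entry; under eq_cvg do rewrite bezout_entry.
  apply: cvgD; last by under eq_cvg do rewrite Diag_damp; exact: cvg_cst.
  by apply: cvgM; [apply: cvgM => // |]; exact: hx.
(* In the limit, only the bounded orthants contribute to a moment. *)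
have lim_sum (f : nat -> {set 'I_n} -> R) (g : {set 'I_n} -> R) c :
    (forall j, \sum_E f j E = c) ->
    (forall E, bdd E -> f j E @[j --> U] --> g E) ->
    (forall E, ~ bdd E -> f j E @[j --> U] --> (0 : R)) ->
    \sum_(E in G) g E = c.
  move=> fc fg f0; rewrite big_mkcond /=.
  have : \sum_E f j E @[j --> U] --> \sum_E (if E \in G then g E else 0).
    by apply: cvg_sumr => E _; case: inG => [/fg|/f0].
  under eq_cvg do rewrite fc.
  move=> h; apply: (@cvg_unique _ (@Rhausdorff R) _ _ _ _ h); exact: cvg_cst.
have mass : \sum_(E in G) weight M (x E) = 1.
  apply: (lim_sum W) => // j; exact: damp_mass.
have mean k : \sum_(E in G) weight M (x E) * x E k 0 = 0.
  apply: (lim_sum (fun j E => W j E * sol j E k 0)).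
  - by move=> j; apply: damp_mean.
  - by move=> E bE; apply: cvgM; [exact: WU | exact: hx].
  - move=> E nb; apply: (WB_small E _ 1 ler01 nb) => j.
    exact: damp_sq_le1 hM M0 (t01' j) (ar j) (aE j) E k.
have off k l : k != l -> \sum_(E in G) weight M (x E) * (x E k 0 * x E l 0) = 0.
  move=> kl; apply: (lim_sum (fun j E => W j E * (sol j E k 0 * sol j E l 0))).
  - by move=> j; apply: damp_offdiag.
  - by move=> E bE; apply: cvgM; [exact: WU | apply: cvgM; exact: hx].
  - move=> E nb; pose B := M k k * M l l / (M k k * M l l - M k l ^+ 2).
    apply: (WB_small E (fun j => sol j E k 0 * sol j E l 0) B _ nb) => [|j].
      by rewrite divr_ge0 ?subr_ge0 ?(ltW (hlt _ _ kl))// mulr_ge0// ltW.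
    exact: (damp_sqsq_le hM M0 (t01' j) (ar j) (aE j) E kl (hlt _ _ kl)).
exists G, x; split => //.
- by move=> E /inG bE; split; [exact: xr | exact: xE].
- move=> y yr.
  have [|E yE] := @orthant_exists R n y.
    by move=> k; apply: root_neq0 yr; rewrite gt_eqF.
  (* An orthant that contains a solution of the limit system is bounded, so G
     misses no solution. *)
  have bE : bdd E.
    exists (\sum_k 2 * (\sum_l M l l) / M k k * `|y k 0|).
    apply: filterS filterT => j _ k /=.
    have axy := orthant_mul (aE j E) yE.
    have t02 : 0 <= t j <= 2^-1 by have /andP[/ltW -> ->] := t01 j.
    have := root_bound hM M0 t02 (ar j E) yr axy k.
    have y0 : y k 0 != 0 by apply: root_neq0 yr; rewrite gt_eqF.
    have -> : sol j E k 0 / y k 0 = `|sol j E k 0| / `|y k 0|.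
      rewrite -normf_div gtr0_norm//.
      have -> : sol j E k 0 / y k 0 = sol j E k 0 * y k 0 / y k 0 ^+ 2 by field.
      by rewrite divr_gt0// exprn_even_gt0.
    rewrite ler_pdivrMr ?normr_gt0// => /le_trans; apply.
    rewrite [leRHS](bigD1 k)//= lerDl sumr_ge0// => i _.
    by rewrite mulr_ge0// divr_ge0// ?(ltW (M0 _))// mulr_ge0// sumr_ge0// => l _; rewrite ltW.
  exists E; first exact/inG.
  apply: (root_unique hM M0 yr (xr E bE)); exact: orthant_mul yE (xE E bE).
- move=> k l; have [<-|kl] := eqVneq k l; last exact: off.
  apply: (@second_moment R n M _ (mem G) x (fun E => weight M (x E)) k) => //.
  + by rewrite gt_eqF.
  + by move=> E /inG; exact: xr.
  + by move=> m; exact: off.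
Qed.

(** * Finitely supported measures *)

Section Atoms.
Local Open Scope ereal_scope.
Context d (T : measurableType d) (R : realType).
Variables (x : nat -> T) (c : nat -> {nonneg R}) (N : nat).

Definition atoms : set T -> \bar R := msum (fun i => mscale (c i) \d_(x i)) N.

HB.instance Definition _ := Measure.copy atoms (msum (fun i => mscale (c i) \d_(x i)) N).

Lemma atomsE A : atoms A = \sum_(i < N) (c i)%:num%:E * \d_(x i) A.
Proof. by []. Qed.

Lemma ge0_integral_atoms (f : T -> \bar R) : measurable_fun setT f ->
  (forall y, 0 <= f y) -> \int[atoms]_y f y = \sum_(i < N) (c i)%:num%:E * f (x i).
Proof.
move=> mf f0; rewrite ge0_integral_measure_sum//; apply: eq_bigr => i _.
by rewrite ge0_integral_mscale// integral_dirac// diracT mul1e.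
Qed.

Lemma integrable_atoms (f : T -> R) : measurable_fun setT f ->
  atoms.-integrable setT (EFin \o f).
Proof.
move=> mf; apply/integrableP; split; first exact/measurable_EFinP.
rewrite ge0_integral_atoms//; last first.
  by apply: measurableT_comp => //; exact/measurable_EFinP.
under eq_bigr do rewrite /= -EFinM.
by rewrite sumEFin ltry.
Qed.

Lemma Rintegral_atoms (f : T -> R) : measurable_fun setT f ->
  (\int[atoms]_y f y = \sum_(i < N) (c i)%:num * f (x i))%R.
Proof.
move=> mf; rewrite /Rintegral integralE.
have mfE : measurable_fun setT (EFin \o f) by exact/measurable_EFinP.
rewrite !ge0_integral_atoms//; [|exact: measurable_funeneg|exact: measurable_funepos].
have E (r : R) : maxe r%:E 0 = (Num.max r 0)%:E by rewrite EFin_max.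
under eq_bigr do rewrite funeposE /= E -EFinM.
under [X in _ - X]eq_bigr do rewrite funenegE /= E -EFinM.
rewrite !sumEFin -EFinB /= -sumrB; apply: eq_bigr => i _.
rewrite -mulrBr; congr (_ * _)%R.
set r := f (x i); have [r0|r0] := leP 0%R r.
  by rewrite (max_idPr _) ?subr0 ?oppr_le0.
by rewrite (max_idPl _) ?oppr_ge0 ?(ltW r0)// sub0r opprK.
Qed.

End Atoms.

Lemma continuous_borel (R : realType) (n : nat) (f : 'cV[R]_n -> R) :
  continuous f -> measurable_fun setT (f : borelRn R n -> R).
Proof.
move=> cf; apply: (measurability _ (RGenOInfty.measurableE R)).
move=> _ [_ [a ->] <-]; rewrite setTI.
apply: sub_sigma_algebra; apply: open_comp => //; exact: rray_open.
Qed.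

Lemma singleton_borel (R : realType) (n : nat) (y : 'cV[R]_n) :
  measurable ([set y] : set (borelRn R n)).
Proof.
rewrite -[X in measurable X]setCK; apply: measurableC.
apply: sub_sigma_algebra; apply: closed_openC.
exact: (accessible_closed_set1 (hausdorff_accessible (@norm_hausdorff R _))).
Qed.

(** * Complex solutions *)

Lemma toC_root (R : realType) (n : nat) (M : 'M[R]_n) (y : 'cV[R]_n) :
  IDelta M (toC y) <-> is_root M y.
Proof.
have E k : toC y k 0 * (toC M *m toC y) k 0 = (y k 0 * (M *m y) k 0)%:C%C.
  by rewrite /toC -map_mxM !mxE -rmorphM.
by split=> H k; have := H k; rewrite E [toC M k k]mxE; [move/complexI | move=> ->].
Qed.

(** With a = x + i y, eliminating (M x)_k between the real and imaginary parts of
    a_k (M a)_k = m_kk gives y_k (M y)_k = - m_kk y_k^2 / (x_k^2 + y_k^2).  The sum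
    over k is nonnegative on the left, so every y_k vanishes. *)
Lemma root_real (R : realType) (n : nat) (M : 'M[R]_n) (a : 'cV[R[i]]_n) :
  real_gram M -> (forall k, 0 < M k k) -> IDelta M a -> a = toC (reC a).
Proof.
move=> [_ Mpos] M0 ar.
pose x := reC a; pose y : 'cV[R]_n := map_mx (@complex.Im R) a.
have ck u v : (u +i* v)%C = u%:C%C + 'i%C * v%:C%C :> R[i] by rewrite [LHS]complexE.
have Ea : a = toC x + 'i%C *: toC y.
  by apply/matrixP => k j; rewrite !mxE [LHS]complexE.
have Ma k : (toC M *m a) k 0 = ((M *m x) k 0 +i* (M *m y) k 0)%C.
  have cc (A B : 'cV[R]_n) : (toC A + 'i%C *: toC B) k 0 = (A k 0 +i* B k 0)%C.
    by rewrite ck !mxE.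
  by rewrite Ea mulmxDr -scalemxAr /toC -!map_mxM; exact: cc.
have ak k : a k 0 = (x k 0 +i* y k 0)%C by rewrite !mxE; case: (a k 0).
have reim k : (x k 0 * (M *m x) k 0 - y k 0 * (M *m y) k 0 = M k k) /\
    (x k 0 * (M *m y) k 0 + y k 0 * (M *m x) k 0 = 0).
  by have := ar k; rewrite Ma ak [toC M k k]mxE => -[-> ->].
have re k := (reim k).1; have im k := (reim k).2.
have n0 k : 0 < x k 0 ^+ 2 + y k 0 ^+ 2.
  rewrite lt_neqAle addr_ge0 ?sqr_ge0// andbT eq_sym paddr_eq0 ?sqr_ge0// !sqrf_eq0.
  apply/negP => /andP[/eqP x0 /eqP y0]; have := re k.
  by rewrite x0 y0 !mul0r subr0 => /esym/eqP; rewrite gt_eqF.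
have My k : y k 0 * (M *m y) k 0 = - (M k k * y k 0 ^+ 2 / (x k 0 ^+ 2 + y k 0 ^+ 2)).
  have d0 := n0 k; apply: (mulIf (lt0r_neq0 d0)).
  rewrite mulNr divfK ?gt_eqF// -(re k).
  have := im k; set X := (M *m x) k 0; set Y := (M *m y) k 0 => H.
  have -> : y k 0 * Y * (x k 0 ^+ 2 + y k 0 ^+ 2) =
    y k 0 * x k 0 * (x k 0 * Y) + y k 0 ^+ 3 * Y by ring.
  have -> : x k 0 * Y = - (y k 0 * X) by apply/eqP; rewrite -addr_eq0 H.
  ring.
have y0 k : y k 0 = 0.
  have T i : 0 <= M i i * y i 0 ^+ 2 / (x i 0 ^+ 2 + y i 0 ^+ 2).
    by rewrite divr_ge0 ?(ltW (n0 i))// mulr_ge0 ?sqr_ge0// ltW.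
  have := Mpos y; rewrite quadE (eq_bigr _ (fun i _ => My i)) sumrN oppr_ge0 => s0.
  have : \sum_i M i i * y i 0 ^+ 2 / (x i 0 ^+ 2 + y i 0 ^+ 2) == 0.
    by rewrite eq_le s0 sumr_ge0.
  rewrite psumr_eq0// => /allP/(_ k (mem_index_enum _)).
  by rewrite !mulf_eq0 invr_eq0 (gt_eqF (n0 k)) (gt_eqF (M0 k)) orbF orbb => /eqP.
apply/matrixP => k j; rewrite ord1 !mxE [LHS]complexE.
have := y0 k; rewrite mxE => ->.
by rewrite mulr0 addr0.
Qed.

Lemma cDelta_toC (R : realType) (n : nat) (M : 'M[R]_n) (y : 'cV[R]_n) :
  cDelta M (toC y) = (weight M y)%:C%C.
Proof.
rewrite /cDelta /weight /bezout rmorphM fmorphV -!det_map_mx.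
congr (_ / \det _).
have -> : D (toC y) = map_mx (real_complex R) (D y).
  by apply/matrixP => k l; rewrite !mxE rmorphMn.
by rewrite [in RHS]map_mxD !map_mxM.
Qed.

Lemma toC_inj (R : realType) (m n : nat) : injective (@toC R m n).
Proof. by move=> A B /matrixP E; apply/matrixP => i j; have := E i j; rewrite !mxE => /complexI. Qed.

Lemma reC_toC (R : realType) (m n : nat) (A : 'M[R]_(m, n)) : reC (toC A) = A.
Proof. by apply/matrixP => i j; rewrite !mxE. Qed.

Section Assembly.
Variables (R : realType) (n : nat) (M : 'M[R]_n).
Hypotheses (hM : real_gram M) (M0 : forall k, 0 < M k k).
Variables (G : {set {set 'I_n}}) (x : {set 'I_n} -> 'cV[R]_n).
Hypotheses (Gx : forall E, E \in G -> is_root M (x E) /\ in_orthant E (x E))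
  (xG : forall y, is_root M y -> exists2 E, E \in G & y = x E).

Lemma IDelta_image : IDelta M = (fun E => toC (x E)) @` [set` G].
Proof.
rewrite eqEsubset; split=> [a aI|_ [E /= EG <-]]; last first.
  by apply/toC_root; have [] := Gx EG.
have ar := root_real hM M0 aI; rewrite ar in aI *.
by have /toC_root/xG[E EG ->] := aI; exists E.
Qed.

Lemma IDelta_fsbig (T : Type) (idx : T) (op : Monoid.com_law idx) (F : 'cV[R[i]]_n -> T) :
  \big[op/idx]_(a \in IDelta M) F a = \big[op/idx]_(E in G) F (toC (x E)).
Proof.
rewrite IDelta_image fsbig_image; last first.
  move=> E F' /[!inE] EG FG /toC_inj EF.
  by have [_ oE] := Gx EG; have [_ oF] := Gx FG; apply: (orthant_inj oE); rewrite EF.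
rewrite -(@bigfs _ _ op _ (index_enum _) (mem G)) ?index_enum_uniq//.
by move=> E _; rewrite mem_index_enum.
Qed.

End Assembly.

Lemma gram_diag_gt0 (R : realType) (n : nat) (M : 'M[R]_n) : (2 <= n)%N -> real_gram M ->
  (forall k l, k != l -> M k l ^+ 2 < M k k * M l l) -> forall k, 0 < M k k.
Proof.
move=> hn [_ Mpos] hlt k.
have [l kl] : exists l : 'I_n, k != l.
  have [k0|k0] := eqVneq k (Ordinal (ltnW hn)); last by exists (Ordinal (ltnW hn)).
  by exists (Ordinal hn); rewrite k0.
rewrite lt_neqAle; apply/andP; split.
  apply: contraTneq (hlt _ _ kl) => <-.
  by rewrite mul0r -leNgt sqr_ge0.
have := Mpos (delta_mx k 0).
by rewrite trmx_delta -rowE -colE !mxE.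
Qed.

Lemma gram_sqr_lt (R : realType) (n : nat) (M : 'M[R]_n) k l :
  `|M k l| < Num.sqrt (M k k * M l l) -> M k l ^+ 2 < M k k * M l l.
Proof.
move=> h; have s0 : 0 < Num.sqrt (M k k * M l l) by apply: le_lt_trans h.
have p0 : 0 <= M k k * M l l by rewrite ltW// -sqrtr_gt0.
by rewrite -(sqr_sqrtr p0) -real_normK ?num_real// ltr_pXn2r ?nnegrE// ltW.
Qed.

(** * The quadrature formula as a probability measure *)

Section Measure.
Variables (R : realType) (n : nat) (M : 'M[R]_n).
Hypotheses (hM : real_gram M) (M0 : forall k, 0 < M k k).
Variables (G : {set {set 'I_n}}) (x : {set 'I_n} -> 'cV[R]_n).

Let W E : {nonneg R} := NngNum (ltW (weight_gt0 (x E) hM M0)).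
Let e i : {set 'I_n} := nth finset.set0 (enum G) i.
Let xs i : borelRn R n := x (e i).
Let cs i : {nonneg R} := W (e i).
Let nu : {measure set (borelRn R n) -> \bar R} := atoms xs cs #|G|.

Let bigE (T : Type) (idx : T) (op : Monoid.com_law idx) (F : {set 'I_n} -> T) :
  \big[op/idx]_(i < #|G|) F (e i) = \big[op/idx]_(E in G) F E.
Proof. by rewrite -[RHS]big_enum (big_nth finset.set0) big_mkord cardE. Qed.

Hypotheses (mass : \sum_(E in G) weight M (x E) = 1)
  (mean : forall k, \sum_(E in G) weight M (x E) * x E k 0 = 0)
  (covar : forall k l, \sum_(E in G) weight M (x E) * (x E k 0 * x E l 0) = (k == l)%:R).

Lemma quadrature_measure : exists mu : probability (borelRn R n) R,
  [/\ forall A, mu A = (\sum_(E in G) (weight M (x E))%:E * \d_(x E : borelRn R n) A)%E,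
      centered mu, discrete_measure mu & isotropic mu].
Proof.
have nuE A : nu A = (\sum_(E in G) (weight M (x E))%:E * \d_(x E : borelRn R n) A)%E.
  by rewrite -bigE; exact: atomsE.
have nuT : nu setT = 1%E.
  by rewrite nuE; under eq_bigr do rewrite diracT mule1; rewrite sumEFin mass.
have intE (f : 'cV[R]_n -> R) : continuous f ->
    nu.-integrable setT (fun y : borelRn R n => (f y)%:E) /\
    \int[nu]_y f y = \sum_(E in G) weight M (x E) * f (x E).
  move=> /continuous_borel mf; split; first exact: integrable_atoms mf.
  by rewrite -bigE; exact: Rintegral_atoms mf.
have coord k : continuous (fun y : 'cV[R]_n => y k 0) by exact: coord_continuous.
have coord2 k l : continuous (fun y : 'cV[R]_n => tens y y k l).
  have -> : (fun y : 'cV[R]_n => tens y y k l) = (fun y => y k 0 * y l 0).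
    by apply/funext => y; rewrite mxE big_ord1 mxE.
  by move=> y; apply: (@cvgM R _ (nbhs y) (nbhs_filter y)); exact: coord.
pose P : probability (borelRn R n) R :=
  HB.pack (atoms xs cs #|G|) (Measure_isProbability.Build _ _ _ _ nuT).
exists P; split.
- exact: nuE.
- split=> [k|]; first exact: (intE _ (coord k)).1.
  by apply/matrixP => k j; rewrite !mxE (intE _ (coord k)).2.
- pose S : set (borelRn R n) := \bigcup_(E in [set` G]) [set x E].
  have fG : finite_set [set` G] by exact: finite_finset.
  exists S; first by apply/finite_set_countable/bigcup_finite.
  exists (~` S); split => //.
    apply/measurableC/fin_bigcup_measurable => // E _; exact: singleton_borel.
  rewrite -[LHS]/(nu (~` S)) nuE big1// => E EG.
  rewrite diracE memNset ?mule0//= => h; apply: h.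
  by exists E.
- split=> [k l|]; first exact: (intE _ (coord2 k l)).1.
  apply/matrixP => k l; rewrite !mxE (intE _ (coord2 k l)).2 -covar.
  by apply: eq_bigr => E _; rewrite mxE big_ord1 [_^T _ _]mxE.
Qed.

End Measure.

Theorem theorem4 (R : realType) (n : nat) (hn : (2 <= n)%N) (M : 'M[R]_n)
    (hM : real_gram M)
    (hlt : forall k l, k != l -> `|M k l| < Num.sqrt (M k k * M l l)) :
  [/\ IDelta M `<=` range (@toC R n 1),
      (forall a, IDelta M a -> 0 < cDelta M a),
      [/\ finite_set (IDelta M),
          \sum_(a \in IDelta M) cDelta M a = 1
        & \sum_(a \in IDelta M) cDelta M a *: tens a a = 1%:M]
    & exists mu : probability (borelRn R n) R,
        [/\ forall A, measurable A -> mu A = muDelta M A,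
            centered mu, discrete_measure mu & isotropic mu]].
Proof.
have hsq k l (kl : k != l) := gram_sqr_lt (hlt k l kl).
have M0 := gram_diag_gt0 hn hM hsq.
have [G [x [Gx xG mass mean covar]]] := gram_quadrature hM M0 hsq.
split.
- by move=> a aI; exists (reC a) => //; rewrite -(root_real hM M0 aI).
- move=> a aI; rewrite (root_real hM M0 aI) cDelta_toC.
  by rewrite -[0]/(0%:C%C) ltcR weight_gt0.
- rewrite !(IDelta_fsbig hM M0 Gx xG); split.
  + by rewrite (IDelta_image hM M0 Gx xG); exact: finite_image.
  + by under eq_bigr do rewrite cDelta_toC; rewrite -rmorph_sum mass.
  + apply/matrixP => k l; rewrite summxE mxE.
    under eq_bigr => E _.
      rewrite mxE cDelta_toC mxE big_ord1 [_^T _ _]mxE 2!mxE -!rmorphM.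
      over.
    by rewrite -rmorph_sum covar rmorph_nat.
- have [mu [muE mu1 mu2 mu3]] := quadrature_measure hM M0 mass mean covar.
  exists mu; split=> // A _; rewrite muE /muDelta (IDelta_fsbig hM M0 Gx xG).
  by apply: eq_bigr => E _; rewrite cDelta_toC reC_toC.
Qed.
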